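(* Let $(X,X_+,\mathcal K,f)$ be an abstract state space and let $\mathcal T=(T_t)_{t\ge 0}$ be a $C_0$-Markov semigroup on $X$. Then the following statements are equivalent: (i) $\mathcal T$ is weakly ergodic, i.e. $\lim_{t\to\infty}\sup_{x,y\in\mathcal K}\|T_tx-T_ty\|=0$; (ii) there exists $t_0\in[0,\infty)$ such that $\delta(T_{t_0})<1$; (iii) $\mathcal T$ is uniformly asymptotically stable, i.e. there is $x_0\in\mathcal K$ with $\lim_{t\to\infty}\|T_t-T_{x_0}\|=0$. Moreover, in this case there are positive constants $C,\alpha,t_0\in\mathbb R$ and $x_0\in\mathcal K$ such that $$\|T_t-T_{x_0}\|\le Ce^{-\alpha t}\qquad\text{for all } t\ge t_0 .$$
   Context: Abstract state space $(X,X_+,\mathcal K,f)$: $X$ is a real vector space ordered by a generating cone $X_+$ (so $X=X_+-X_+$), $f$ is a linear functional on $X$ with $f(x)>0$ for all $x\in X_+\setminus\{0\}$, and $\mathcal K=\{x\in X_+: f(x)=1\}$. Let $U$ be the convex hull of $\mathcal K\cup(-\mathcal K)$ and $\|x\|=\inf\{\lambda\ge0: x\in\lambda U\}$. It is assumed that $\|\cdot\|$ is a norm, that $X$ is complete for it, and that $X_+$ is closed. Norms of operators are operator norms. A linear operator $T:X\to X$ is Markov if it is positive ($Tx\ge0$ whenever $x\ge 0$) and $T(\mathcal K)\subset\mathcal K$. A $C_0$-Markov semigroup is a strongly continuous one-parameter semigroup $(T_t)_{t\ge0}$ on $X$ ($T_0=I$, $T_{t+s}=T_tT_s$, $\|T_tx-x\|\to0$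 as $t\downarrow0$ for every $x\in X$) such that every $T_t$ is Markov. For $y\in X$, $T_y:X\to X$ denotes the operator $T_y(x)=f(x)y$ (not to be confused with the semigroup operators $T_t$, $t\ge0$). Dobrushin's ergodicity coefficient of a Markov operator $T$: with $N=\{x\in X: f(x)=0\}$, $\delta(T)=\sup_{x\in N,\,x\ne0}\|Tx\|/\|x\|$. *)

(* Defs.v *)
From HB Require Import structures.
From mathcomp Require Import all_boot all_order all_algebra.
From mathcomp Require Import all_classical all_reals all_analysis.

Set Implicit Arguments.
Unset Strict Implicit.
Unset Printing Implicit Defensive.

Import Order.TTheory GRing.Theory Num.Theory.
Import numFieldNormedType.Exports.

Local Open Scope classical_set_scope.
Local Open Scope ring_scope.

Definition convex_hull (R : realType) (X : lmodType R) (A : set X) : set X :=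
  smallest (@convex_set R X) A.

Definition base (R : realType) (X : lmodType R) (Xpos : set X)
    (f : {scalar X}) : set X :=
  [set x | Xpos x /\ f x = 1].

Definition base_ball (R : realType) (X : lmodType R) (Xpos : set X)
    (f : {scalar X}) : set X :=
  convex_hull (base Xpos f `|` [set - x | x in base Xpos f]).

(* Extended-real valued, so that an infimum over the empty set is [+oo]. *)
Definition base_gauge (R : realType) (X : lmodType R) (Xpos : set X)
    (f : {scalar X}) (x : X) : \bar R :=
  ereal_inf [set l%:E | l in
    [set l : R | 0 <= l /\ [set l *: u | u in base_ball Xpos f] x]].

Record proper_cone (R : realType) (X : lmodType R) (P : set X) : Prop :=
  ProperCone {
  cone0 : P 0 ;
  coneD : forall x y, P x -> P y -> P (x + y) ;
  coneZ : forall (a : R) x, 0 <= a -> P x -> P (a *: x) ;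
  cone_pointed : forall x, P x -> P (- x) -> x = 0 }.

(* The requirements that the gauge of [base_ball] be a norm and that X be      *)
(* complete for it are expressed by letting X be a complete normed module      *)
(* whose norm is that gauge. As the gauge of the empty set is constantly       *)
(* [+oo], [norm_gauge] also forces the base to be nonempty, i.e., X nonzero.   *)
Record abstract_state_space (R : realType) (X : completeNormedModType R)
    (Xpos : set X) (f : {scalar X}) : Prop := AbstractStateSpace {
  Xpos_cone : proper_cone Xpos ;
  Xpos_generating : forall x, exists y z, [/\ Xpos y, Xpos z & x = y - z] ;
  f_strictly_positive : forall x, Xpos x -> x != 0 -> 0 < f x ;
  norm_gauge : forall x, (`|x|)%:E = base_gauge Xpos f x ;
  Xpos_closed : closed Xpos }.

Definition opnorm (R : realType) (X : normedModType R) (A : X -> X) : \bar R :=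
  ereal_sup [set (`|A x|)%:E | x in [set x | `|x| <= 1]].

Definition rank_one (R : realType) (X : lmodType R) (f : {scalar X}) (y : X) :
    X -> X :=
  fun x => f x *: y.

Definition markov_operator (R : realType) (X : lmodType R) (Xpos : set X)
    (f : {scalar X}) (T : {linear X -> X}) : Prop :=
  (forall x, Xpos x -> Xpos (T x)) /\
  (forall x, base Xpos f x -> base Xpos f (T x)).

(* Only the values of the family at t >= 0 are constrained or used. *)
Record C0_markov_semigroup (R : realType) (X : normedModType R) (Xpos : set X)
    (f : {scalar X}) (T : R -> {linear X -> X}) : Prop := C0MarkovSemigroup {
  semigroup0 : forall x, T 0 x = x ;
  semigroupD : forall t s x, 0 <= t -> 0 <= s -> T (t + s) x = T t (T s x) ;
  semigroup_cvg0 : forall x, `|T t x - x| @[t --> 0^'+] --> (0 : R) ;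
  semigroup_markov : forall t, 0 <= t -> markov_operator Xpos f (T t) }.

(* If X is one-dimensional the supremum is over the empty set and is [-oo];    *)
(* in all other cases it is nonnegative.                                       *)
Definition dobrushin (R : realType) (X : normedModType R) (f : {scalar X})
    (T : X -> X) : \bar R :=
  ereal_sup [set (`|T x| / `|x|)%:E | x in [set x | f x = 0 /\ x != 0]].

Definition weakly_ergodic (R : realType) (X : normedModType R) (Xpos : set X)
    (f : {scalar X}) (T : R -> {linear X -> X}) : Prop :=
  ereal_sup [set (`|T t x - T t y|)%:E | x in base Xpos f & y in base Xpos f]
    @[t --> +oo%R] --> 0%E.

Definition uniformly_asymptotically_stable (R : realType)
    (X : normedModType R) (Xpos : set X) (f : {scalar X})
    (T : R -> {linear X -> X}) : Prop :=
  exists2 x0, base Xpos f x0 &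
    opnorm (T t \- rank_one f x0) @[t --> +oo%R] --> 0%E.

(* Main.v *)
(* Every x in the kernel N of f is, up to an arbitrarily small error in the
   norm, |x|/2 times a difference of two elements of the base, so the supremum
   in (i) at time t is twice the norm of T_t on N. If T_{t0} contracts N by
   d < 1, then by the semigroup law |T_t| on N decays like d^(t/t0). The orbit
   of any k in the base is then Cauchy, as T_s k - k lies in N, and its limit
   x0 satisfies T_t x -> f(x) x0 at the same exponential rate. *)
Require Import Defs.
From HB Require Import structures.
From mathcomp Require Import all_boot all_order all_algebra.
From mathcomp Require Import all_classical all_reals all_analysis.
From mathcomp Require Import ring lra.

Import Order.TTheory GRing.Theory Num.Theory.
Import numFieldNormedType.Exports.

Local Open Scope classical_set_scope.
Local Open Scope ring_scope.

(** * Exponential bounds and limits at infinity *)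

Lemma cvg_scaled_expRN {R : realType} (M : R) [a : R] :
  0 < a -> M * expR (- a * t) @[t --> +oo] --> (0 : R).
Proof.
move=> a0; rewrite -(mulr0 M); apply: cvgM; first exact: cvg_cst.
under eq_fun do rewrite mulNr.
by apply: cvg_comp (@cvgr_expR R); apply: gt0_cvgMry => //; exact: cvg_id.
Qed.

Lemma ecvg0_exists_lt {R : realType} [g : R -> \bar R] [e : R] :
  0 < e -> g t @[t --> +oo] --> 0%E -> exists t, 0 <= t /\ (g t < e%:E)%E.
Proof.
move=> e0 g0; apply: (@filter_ex _ (pinfty_nbhs R)).
have ge : \forall t \near +oo, (g t < e%:E)%E.
  apply: (g0 [set x | (x < e%:E)%E]).
  by apply: (@open_ereal_lt' _ 0%E); rewrite lte_fin.
near=> t; split; last by near: t.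
by near: t; exact: nbhs_pinfty_ge (num_real _).
Unshelve. all: by end_near. Qed.

Lemma exponential_ecvg0 {R : realType} [g : R -> \bar R] [M a : R] :
  0 < a -> (forall t, (0 <= g t)%E) ->
  (forall t, 0 <= t -> (g t <= (M * expR (- a * t))%:E)%E) ->
  g t @[t --> +oo] --> 0%E.
Proof.
move=> a0 g0 gM.
apply: (@squeeze_cvge _ _ _ _ (cst 0%E) _ (fun t => (M * expR (- a * t))%:E)).
- near=> t; apply/andP; split; first exact: g0.
  by apply: gM; near: t; exact: nbhs_pinfty_ge (num_real _).
- exact: cvg_cst.
- by apply: cvg_EFin; [near=> t|exact: cvg_scaled_expRN].
Unshelve. all: by end_near. Qed.

(** * The base norm and its decompositions *)

Section state_space.
Set Implicit Arguments.
Unset Strict Implicit.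
Context (R : realType) (X : completeNormedModType R) (Xpos : set X)
  (f : {scalar X}) (hX : abstract_state_space Xpos f).
Implicit Types (x y z k : X) (S : {linear X -> X}).

Let K := base Xpos f.

Lemma functional_ge0 x : Xpos x -> 0 <= f x.
Proof.
move=> Px; have [->|x0] := eqVneq x 0; first by rewrite linear0.
by apply/ltW/(f_strictly_positive hX).
Qed.

Lemma base_normalize y : Xpos y -> y != 0 -> K ((f y)^-1 *: y).
Proof.
move=> Py y0; have fy := f_strictly_positive hX Py y0; split.
  by apply: (coneZ (Xpos_cone hX)) => //; rewrite invr_ge0 ltW.
by rewrite scalarZ mulVf// gt_eqF.
Qed.

Lemma norm_le_functional y : Xpos y -> `|y| <= f y.
Proof.
move=> Py; have [->|y0] := eqVneq y 0; first by rewrite normr0 linear0.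
have fy := f_strictly_positive hX Py y0.
rewrite -lee_fin (norm_gauge hX); apply: ereal_inf_lbound.
exists (f y) => //; split; first exact: ltW.
exists ((f y)^-1 *: y); last by rewrite scalerA mulfV ?gt_eqF// scale1r.
by apply: sub_gen_smallest; left; exact: base_normalize.
Qed.

(** The points of this form make up a convex set containing the base and its negative, hence
    containing their hull. *)
Lemma base_ball_decomposition u : base_ball Xpos f u ->
  exists y z, [/\ Xpos y, Xpos z, u = y - z & f y + f z = 1].
Proof.
have cX := Xpos_cone hX; have P0 := cone0 cX.
pose W := [set u | exists y z, [/\ Xpos y, Xpos z, u = y - z & f y + f z = 1]].
apply: (@smallest_sub _ _ _ W).
- move=> u1 u2 l; rewrite !inE.
  move=> [y [z [Py Pz -> yz1]]] [y' [z' [Py' Pz' -> yz1']]].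
  have l0 : 0 <= l%:num by [].
  have l1 : 0 <= 1 - l%:num by rewrite subr_ge0.
  exists (l%:num *: y + (1 - l%:num) *: y').
  exists (l%:num *: z + (1 - l%:num) *: z'); split.
  + by apply: (coneD cX); apply: (coneZ cX).
  + by apply: (coneD cX); apply: (coneZ cX).
  + by rewrite opprD addrACA -!scalerBr.
  + rewrite !linearD !scalarZ.
    rewrite addrACA -!mulrDr yz1 yz1'; lra.
- move=> x [[Px fx]|[k [Pk fk] <-]].
  + by exists x, 0; rewrite subr0 linear0 addr0.
  + by exists 0, k; rewrite sub0r linear0 add0r.
Qed.

(** A near-minimiser [l] of the gauge rescales a decomposition of a point of the base ball. The
    slack [e] is there because the infimum need not be attained. *)
Lemma norm_decomposition x (e : R) : 0 < e ->
  exists y z, [/\ Xpos y, Xpos z, x = y - z & f y + f z <= `|x| + e].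
Proof.
move=> e0; have : (base_gauge Xpos f x < (`|x| + e)%:E)%E.
  by rewrite -(norm_gauge hX) lte_fin ltrDl.
move=> /ereal_inf_lt[_ [l [l0 [u Bu <-]] <-]]; rewrite lte_fin => lx.
have [y [z [Py Pz uyz yz1]]] := base_ball_decomposition Bu.
have cX := Xpos_cone hX.
exists (l *: y), (l *: z); split; [exact: (coneZ cX)|exact: (coneZ cX)| |].
  by rewrite uyz scalerBr.
by rewrite !scalarZ -mulrDr yz1 mulr1 ltW.
Qed.

(** The gauge is finite at 0, so the base ball has a point; one of the two parts of its
    decomposition is nonzero and can be normalised. *)
Lemma base_nonempty : K !=set0.
Proof.
have : (base_gauge Xpos f 0 < 1%:E)%E by rewrite -(norm_gauge hX) normr0 lte_fin.
move=> /ereal_inf_lt[_ [l [_ [u Bu _]] _] _].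
have [y [z [Py Pz _ yz1]]] := base_ball_decomposition Bu.
have [y0|y0] := eqVneq y 0; last by eexists; exact: base_normalize y0.
have [z0|z0] := eqVneq z 0; last by eexists; exact: base_normalize z0.
by move: yz1; rewrite y0 z0 linear0 addr0 => /esym/eqP; rewrite oner_eq0.
Qed.

Lemma base_norm_le1 k : K k -> `|k| <= 1.
Proof. by move=> [Pk fk]; rewrite -fk norm_le_functional. Qed.

Lemma functional_norm_le x : `|f x| <= `|x|.
Proof.
apply/ler_addgt0Pr => e /(norm_decomposition x)[y [z [Py Pz -> le_yz]]].
apply: le_trans le_yz; rewrite linearB (le_trans (ler_normB _ _))//.
by rewrite !ger0_norm ?functional_ge0.
Qed.

Lemma functional_continuous : continuous f.
Proof.
move=> x; apply/cvgrPdist_lt => e e0; near=> y.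
rewrite -linearB (le_lt_trans (functional_norm_le _))//.
Unshelve. all: by end_near. Qed.

(** This keeps the limit of an orbit of base elements inside the base. *)
Lemma base_closed : closed K.
Proof.
apply: closedI; first exact: Xpos_closed hX.
apply: (@preimage_closed _ _ f [set r | r = 1]); last exact: closed_eq.
by move=> x _; exact: functional_continuous.
Qed.

(** * Operator bounds on the whole space and on the kernel of [f] *)

Lemma markov_functional S x : markov_operator Xpos f S -> f (S x) = f x.
Proof.
(* The cone generates, so linearity reduces the claim to the cone, whose nonzero vectors are
   multiples of base elements. *)
move=> [_ SK]; suff pos y : Xpos y -> f (S y) = f y.
  by have [y [z [Py Pz ->]]] := Xpos_generating hX x; rewrite !linearB !pos.
move=> Py; have [->|y0] := eqVneq y 0; first by rewrite !linear0.
have fy := f_strictly_positive hX Py y0.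
have [_] := SK _ (base_normalize Py y0).
rewrite linearZ scalarZ => /(congr1 ( *%R (f y))).
by rewrite mulVKf ?gt_eqF// mulr1.
Qed.

(** Both parts of a nearly optimal decomposition stay in the cone with unchanged [f], which bounds
    the norm there. *)
Lemma markov_norm_le S x : markov_operator Xpos f S -> `|S x| <= `|x|.
Proof.
move=> mS; have [Spos _] := mS; apply/ler_addgt0Pr => e.
move=> /(norm_decomposition x)[y [z [Py Pz -> le_yz]]].
apply: le_trans le_yz; rewrite linearB (le_trans (ler_normB _ _))// lerD//.
  by rewrite -(markov_functional _ mS) norm_le_functional//; exact: Spos.
by rewrite -(markov_functional _ mS) norm_le_functional//; exact: Spos.
Qed.

(** For [x = y - z] in the kernel, [f y = f z], so [x] is [f y] times a difference of base elements;
    near-optimality bounds [2 * f y] by the norm up to an error, whence [c / 2]. *)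
Lemma kernel_norm_le S (c : R) :
  (forall k1 k2, K k1 -> K k2 -> `|S k1 - S k2| <= c) ->
  forall x, f x = 0 -> `|S x| <= c / 2 * `|x|.
Proof.
move=> Sc x fx0.
have c0 : 0 <= c by have [k Kk] := base_nonempty; exact: le_trans (Sc k k Kk Kk).
apply/ler_addgt0Pr => e e0.
(* The error gets multiplied by [c]; dividing by [c + 1] keeps the product below [e] and is safe
   when [c = 0]. *)
have e'0 : 0 < e / (c + 1) by rewrite divr_gt0// ltr_wpDl.
have [y [z [Py Pz xyz le_yz]]] := norm_decomposition x e'0.
have fyz : f y = f z by apply/eqP; rewrite -subr_eq0 -linearB -xyz fx0.
have Sx : `|S x| <= c * f y.
  have [y0|y0] := eqVneq y 0.
    have z0 : z = 0.
      apply/eqP/negPn/negP => z0; have := f_strictly_positive hX Pz z0.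
      by rewrite -fyz y0 linear0 ltxx.
    by rewrite xyz y0 z0 subrr !linear0 normr0 mulr0.
  have fy := f_strictly_positive hX Py y0.
  have z0 : z != 0.
    by apply/eqP => z0; move: fy; rewrite fyz z0 linear0 ltxx.
  have := Sc _ _ (base_normalize Py y0) (base_normalize Pz z0).
  rewrite -fyz -linearB -scalerBr -xyz linearZ normrZ gtr0_norm ?invr_gt0//.
  by rewrite ler_pdivrMl// mulrC.
have ce : c * (e / (c + 1)) <= e.
  by rewrite mulrCA ler_piMr ?(ltW e0)// ler_pdivrMr ?mul1r ?lerDl// ltr_wpDl.
have e'c : c * (2 * f y) <= c * (`|x| + e / (c + 1)).
  by rewrite ler_wpM2l// (le_trans _ le_yz)// -fyz; lra.
lra.
Qed.

(** The bound is trivial at [x = 0], which the supremum omits, so a zero kernel, with supremum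
    [-oo], is covered. *)
Lemma dobrushin_leP S (d : R) :
  (dobrushin f S <= d%:E)%E <-> (forall x, f x = 0 -> `|S x| <= d * `|x|).
Proof.
split=> [dS x fx0|dS].
  have [->|x0] := eqVneq x 0; first by rewrite linear0 !normr0 mulr0.
  rewrite -ler_pdivrMr ?normr_gt0// -lee_fin (le_trans _ dS)//.
  by apply: ereal_sup_ubound; exists x.
apply: ge_ereal_sup => _ [x [fx0 x0] <-].
by rewrite lee_fin ler_pdivrMr ?normr_gt0// dS.
Qed.

(** * Exponential decay and the limit of the semigroup *)

Context (T : R -> {linear X -> X}) (hT : C0_markov_semigroup Xpos f T).

Lemma semigroup_kernel t x : 0 <= t -> f x = 0 -> f (T t x) = 0.
Proof. by move=> t0 <-; apply: markov_functional; exact: semigroup_markov. Qed.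

Lemma semigroup_iter_kernel_le (tau d : R) : 0 <= tau -> 0 <= d ->
  (forall x, f x = 0 -> `|T tau x| <= d * `|x|) ->
  forall n x, f x = 0 -> `|T (n%:R * tau) x| <= d ^+ n * `|x|.
Proof.
move=> tau0 d0 Td; elim=> [|n IHn] x fx0.
  by rewrite mul0r (semigroup0 hT) mul1r.
have ntau0 : 0 <= n%:R * tau by rewrite mulr_ge0.
rewrite -addn1 natrD mulrDl mul1r addrC (semigroupD hT)//.
rewrite (le_trans (Td _ (semigroup_kernel ntau0 fx0)))//.
by rewrite addn1 exprS -mulrA ler_wpM2l// IHn.
Qed.

(** Write [t] as [n * tau + r] with [r] nonnegative: the multiple of [tau] contributes [d ^+ n], and
    [T r] does not increase the norm. *)
Lemma kernel_exponential_decay (t0 : R) :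
  0 <= t0 -> (dobrushin f (T t0) < 1)%E ->
  exists C a : R, [/\ 0 < C, 0 < a &
    forall t x, 0 <= t -> f x = 0 -> `|T t x| <= C * expR (- a * t) * `|x|].
Proof.
move=> t0_ge0 dob.
(* The factor must be positive for [ln d] to give a rate, hence the maximum with 1/2, and 1/2 itself
   when the coefficient is [-oo]. *)
have [d [d0 d1 dobd]] : exists d : R,
    [/\ 0 < d, d < 1 & (dobrushin f (T t0) <= d%:E)%E].
  case: dobrushin dob => [r||]// => [r1|_]; last first.
    by exists (1 / 2); split; [lra|lra|rewrite leNye].
  rewrite lte_fin in r1; exists (Num.max r (1 / 2)).
  by rewrite lee_fin le_max lexx lt_max gt_max; split; lra.
have {}dobd := (dobrushin_leP _ _).1 dobd.
have [tau [tau0 Td]] : exists tau : R,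
    0 < tau /\ forall x, f x = 0 -> `|T tau x| <= d * `|x|.
  move: t0_ge0; rewrite le_eqVlt => /orP[/eqP t00|t0_gt0]; last by exists t0.
  (* dobrushin f id < 1 forces N = 0, so any positive time will do. *)
  exists 1; split=> // x fx0.
  have : `|x| <= d * `|x| by rewrite -{1}(semigroup0 hT x) t00 dobd.
  have := normr_ge0 x; rewrite le_eqVlt => /orP[/eqP x0|x0].
    move/esym/eqP : x0; rewrite normr_eq0 => /eqP ->.
    by rewrite linear0 normr0 mulr0.
  by rewrite ler_pMl// leNgt d1.
have lnd : ln d < 0 by rewrite ln_lt0// d0.
exists d^-1, (- ln d / tau); split.
- by rewrite invr_gt0.
- by rewrite divr_gt0// oppr_gt0.
move=> t x t_ge0 fx0; set n := Num.trunc (t / tau).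
have /andP[n_le n_gt] := truncn_itv (divr_ge0 t_ge0 (ltW tau0)).
have r0 : 0 <= t - n%:R * tau by rewrite subr_ge0 -ler_pdivlMr.
have ntau0 : 0 <= n%:R * tau by rewrite mulr_ge0// ltW.
rewrite -{1}(subrK (n%:R * tau) t) (semigroupD hT)//.
rewrite (le_trans (markov_norm_le _ (semigroup_markov hT r0)))//.
rewrite (le_trans (semigroup_iter_kernel_le (ltW tau0) (ltW d0) Td _ fx0))//.
(* The constant [d^-1] absorbs the rounding of [t / tau]: it turns [d ^+ n] into [d ^+ n.+1], where
   [n.+1] exceeds [t / tau] and [ln d] is negative. *)
rewrite ler_wpM2r// ler_pdivlMl// -exprS -[d in d ^+ _]lnK ?posrE// -expRM_natl.
rewrite ler_expR (_ : _ * t = t / tau * ln d); last by field; rewrite gt_eqF.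
by rewrite ler_wnM2r// ltW.
Qed.

Lemma exponential_decay_limit (C a : R) : 0 < C -> 0 < a ->
  (forall t x, 0 <= t -> f x = 0 -> `|T t x| <= C * expR (- a * t) * `|x|) ->
  exists2 x0, K x0 & forall t, 0 <= t ->
    (opnorm (T t \- rank_one f x0)%R <= (4 * C * expR (- a * t))%:E)%E.
Proof.
move=> C0 a0 decay; have [k Kk] := base_nonempty.
(* The factor 2 bounds the norm of a difference of base elements, and that of [x - f x *: k] for [x]
   in the unit ball. *)
pose D (t : R) := C * expR (- a * t) * 2.
have CE0 t : 0 <= C * expR (- a * t) by rewrite mulr_ge0 ?expR_ge0// ltW.
have TK (t : R) : 0 <= t -> K (T t k).
  by move=> t0; have [_ TtK] := semigroup_markov hT t0; exact: TtK.
have kerK u v : K u -> K v -> f (u - v) = 0.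
  by move=> [_ fu] [_ fv]; rewrite linearB fu fv subrr.
have distK (t s : R) : 0 <= t -> t <= s -> `|T t k - T s k| <= D t.
  move=> t0 ts; have st0 : 0 <= s - t by rewrite subr_ge0.
  (* By the semigroup law the difference is [T t] applied to [k - T (s - t) k], a kernel element. *)
  rewrite -{1}(subrK t s) [_ - t + t]addrC (semigroupD hT)// -linearB.
  rewrite (le_trans (decay _ _ t0 (kerK _ _ Kk (TK _ st0))))//.
  rewrite ler_wpM2l// (le_trans (ler_normB _ _))// (_ : 2 = 1 + 1)//.
  by rewrite lerD// base_norm_le1//; exact: TK.
have D_cvg0 : D t @[t --> +oo] --> 0.
  by rewrite /D; under eq_fun do rewrite mulrAC; exact: cvg_scaled_expRN.
have /cauchy_cvg Tk_cvg : cauchy (T t k @[t --> +oo]).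
  apply: cauchy_exP => e e0.
  have : \forall t \near +oo, 0 <= t /\ D t < e.
    near=> t; split; near: t; first exact: nbhs_pinfty_ge (num_real _).
    exact: cvgr_lt D_cvg0 _ e0.
  move=> /filter_ex[t [t0 Dte]]; exists (T t k).
  suff : \forall s \near +oo, ball (T t k) e (T s k) by [].
  near=> s; rewrite -ball_normE /=; apply: le_lt_trans (distK t s t0 _) Dte.
  by near: s; exact: nbhs_pinfty_ge (num_real _).
pose x0 := lim (T t k @[t --> +oo]).
have x0_dist (t : R) : 0 <= t -> `|T t k - x0| <= D t.
  move=> t0.
  (* Letting [s] tend to infinity in [distK] preserves the bound. *)
  have : T t k - T s k @[s --> +oo] --> T t k - x0.
    by apply: cvgB; [exact: cvg_cst|exact: Tk_cvg].
  move=> /cvg_norm; apply: (closed_cvg (fun r => r <= D t)).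
    exact: closed_le.
  by near=> s; apply: distK => //; near: s; exact: nbhs_pinfty_ge (num_real _).
exists x0.
  apply: (closed_cvg K base_closed _ _ Tk_cvg).
  by near=> t; apply: TK; near: t; exact: nbhs_pinfty_ge (num_real _).
move=> t t0; apply: ge_ereal_sup => _ [x /= x1 <-]; rewrite lee_fin /rank_one.
have fx1 : `|f x| <= 1 by rewrite (le_trans (functional_norm_le _)).
have fker : f (x - f x *: k) = 0.
  by rewrite linearB scalarZ Kk.2 mulr1 subrr.
(* Comparison with the orbit of [k] leaves a kernel term and the distance of that orbit to its
   limit. Each is at most [D t], which yields the constant [4 * C]. *)
rewrite (_ : _ - _ = T t (x - f x *: k) + f x *: (T t k - x0)); last first.
  by rewrite linearB [T t (_ *: k)]linearZ scalerBr addrA subrK.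
rewrite (le_trans (ler_normD _ _))//.
have le1 : `|T t (x - f x *: k)| <= D t.
  rewrite (le_trans (decay _ _ t0 fker))// ler_wpM2l//.
  rewrite (le_trans (ler_normB _ _))// (_ : 2 = 1 + 1)// lerD// normrZ.
  by rewrite mulr_ile1// base_norm_le1.
have le2 : `|f x *: (T t k - x0)| <= D t.
  by rewrite normrZ (le_trans _ (x0_dist _ t0))// ler_piMl.
by rewrite (le_trans (lerD le1 le2))// /D; lra.
Unshelve. all: by end_near. Qed.

(** * The implications between the three conditions *)

Lemma weakly_ergodic_dobrushin : weakly_ergodic Xpos f T ->
  exists t0 : R, 0 <= t0 /\ (dobrushin f (T t0) < 1)%E.
Proof.
(* Where the supremum is below 1, [kernel_norm_le] with constant 1 bounds the coefficient by 1/2. *)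
move=> /(ecvg0_exists_lt ltr01)[t [t0 supt]]; exists t; split=> //.
have half1 : ((1 / 2 : R)%:E < 1)%E by rewrite lte_fin; lra.
apply: le_lt_trans half1; apply/dobrushin_leP.
apply: kernel_norm_le => k1 k2 Kk1 Kk2; rewrite -lee_fin.
by apply: le_trans (ltW supt); apply: ereal_sup_ubound; exists k1 => //; exists k2.
Qed.

(** Once the operator distance is below 1/2, images of base elements lie within 1/2 of [x0], so
    within 1 of each other, and the coefficient is at most 1/2. *)
Lemma stable_dobrushin : uniformly_asymptotically_stable Xpos f T ->
  exists t0 : R, 0 <= t0 /\ (dobrushin f (T t0) < 1)%E.
Proof.
have e0 : 0 < 1 / 2 :> R by lra.
move=> [x0 Kx0] /(ecvg0_exists_lt e0)[t [t0 normt]]; exists t; split=> //.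
have half1 : ((1 / 2 : R)%:E < 1)%E by rewrite lte_fin; lra.
have close k : K k -> `|T t k - x0| <= 1 / 2.
  move=> Kk; rewrite -lee_fin; apply: le_trans (ltW normt).
  apply: ereal_sup_ubound; exists k; first exact: base_norm_le1.
  by rewrite /rank_one /= Kk.2 scale1r.
apply: le_lt_trans half1; apply/dobrushin_leP.
apply: kernel_norm_le => k1 k2 Kk1 Kk2.
rewrite -[T t k1](subrK x0) -addrA (le_trans (ler_normD _ _))//.
by rewrite [`|x0 - _|]distrC (le_trans (lerD (close _ Kk1) (close _ Kk2)))//; lra.
Qed.

Lemma dobrushin_weakly_ergodic (t0 : R) :
  0 <= t0 -> (dobrushin f (T t0) < 1)%E -> weakly_ergodic Xpos f T.
Proof.
move=> t0_ge0 /(kernel_exponential_decay t0_ge0)[C [a [C0 a0 decay]]].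
apply: (@exponential_ecvg0 _ _ (2 * C) _ a0) => t.
  (* A diagonal pair contributes 0, so the supremum is nonnegative. *)
  have [k Kk] := base_nonempty; apply: ereal_sup_ubound.
  by exists k => //; exists k => //; rewrite subrr normr0.
move=> t_ge0; apply: ge_ereal_sup => _ [k1 Kk1 [k2 Kk2 <-]].
rewrite lee_fin -linearB (le_trans (decay _ _ t_ge0 _))//.
  by rewrite linearB Kk1.2 Kk2.2 subrr.
rewrite -[leRHS]mulrA [leRHS]mulrC ler_wpM2l ?mulr_ge0 ?expR_ge0 ?(ltW C0)//.
by rewrite (le_trans (ler_normB _ _))// (_ : 2 = 1 + 1)// lerD// base_norm_le1.
Qed.

Lemma dobrushin_exponentially_stable (t0 : R) :
  0 <= t0 -> (dobrushin f (T t0) < 1)%E ->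
  exists C a : R, exists x0, [/\ 0 < C, 0 < a, K x0 & forall t, 0 <= t ->
    (opnorm (T t \- rank_one f x0)%R <= (C * expR (- a * t))%:E)%E].
Proof.
move=> t0_ge0 /(kernel_exponential_decay t0_ge0)[C [a [C0 a0 decay]]].
have [x0 Kx0 le_x0] := exponential_decay_limit C0 a0 decay.
by exists (4 * C), a, x0; split=> //; rewrite mulr_gt0.
Qed.

Lemma dobrushin_stable (t0 : R) : 0 <= t0 -> (dobrushin f (T t0) < 1)%E ->
  uniformly_asymptotically_stable Xpos f T.
Proof.
move=> t0_ge0 /(dobrushin_exponentially_stable t0_ge0).
move=> [C [a [x0 [C0 a0 Kx0 decay]]]]; exists x0 => //.
apply: exponential_ecvg0 a0 _ decay => t.
apply: ereal_sup_ubound; exists 0; first by rewrite /= normr0.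
by rewrite /rank_one /= !linear0 scale0r subr0 normr0.
Qed.

End state_space.

Theorem theorem3p1 (R : realType) (X : completeNormedModType R)
    (Xpos : set X) (f : {scalar X}) (T : R -> {linear X -> X})
    (hX : abstract_state_space Xpos f)
    (hT : C0_markov_semigroup Xpos f T) :
  [/\ weakly_ergodic Xpos f T <->
        (exists t0 : R, 0 <= t0 /\ (dobrushin f (T t0) < 1)%E),
      (exists t0 : R, 0 <= t0 /\ (dobrushin f (T t0) < 1)%E) <->
        uniformly_asymptotically_stable Xpos f T
    & weakly_ergodic Xpos f T ->
        exists C alpha t0 : R, exists x0 : X,
          [/\ 0 < C, 0 < alpha, 0 < t0, base Xpos f x0
            & forall t : R, t0 <= t ->
              (opnorm (T t \- rank_one f x0)%R <=
                 (C * expR (- alpha * t))%:E)%E]].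
Proof.
split; first split.
- exact: weakly_ergodic_dobrushin.
- by move=> [t0 [t0_ge0 /(dobrushin_weakly_ergodic hX hT t0_ge0)]].
- split; last exact: stable_dobrushin.
  by move=> [t0 [t0_ge0 /(dobrushin_stable hX hT t0_ge0)]].
- move=> /(weakly_ergodic_dobrushin hX)[t0 [t0_ge0]].
  move=> /(dobrushin_exponentially_stable hX hT t0_ge0).
  (* The bound holds from time 0 on, so 1 is just a convenient positive starting time. *)
  move=> [C [a [x0 [C0 a0 Kx0 decay]]]]; exists C, a, 1, x0.
  by split=> // t t1; apply: decay; exact: le_trans t1.
Qed.
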